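(* Let $\Omega=[0,1]$, equipped with the Lebesgue measure. Then for any $p\in[1,3)$, with $p'=\frac{p}{p-1}$, there exists a sequence $(v_k)$ in $L^\infty([0,1])$ such that $v_k\rightharpoonup 0$ in $L^p([0,1])$ and $|v_k|^{p-2}v_k\rightharpoonup 0$ in $L^{p'}([0,1])$, but, with $u_k=1+v_k$ and $u=1$ (the weak limit of $u_k$), the relation $$\int_{[0,1]}|u_k|^p\,dx\ \ge\ \int_{[0,1]}|u|^p\,dx+\int_{[0,1]}|u_k-u|^p\,dx+o(1)\qquad (k\to\infty)$$ does not hold.
   Context: Functions are real-valued, and $\rightharpoonup$ denotes weak convergence as $k\to\infty$. For $p=1$ the exponent $p'=\frac{p}{p-1}$ is read as $\infty$. The expression $|t|^{p-2}t$ is understood to be $0$ at $t=0$. The relation ''$a_k\ge b_k+o(1)$'' means that there is a real sequence $\varepsilon_k\to 0$ with $a_k\ge b_k+\varepsilon_k$ for all $k$.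
   Formalization: The value p=2 is excluded, since there the relation always holds (the two sides differ by 2∫v_k → 0); for p=1, convergence in L^{p'}=L^∞ is taken as weak-* convergence, since with literal weak convergence the claim fails. *)

(* Defs.v *)
From HB Require Import structures.
From mathcomp Require Import all_boot all_order all_algebra.
From mathcomp Require Import all_classical all_reals all_analysis.

Set Implicit Arguments.
Unset Strict Implicit.
Unset Printing Implicit Defensive.

Import Order.TTheory GRing.Theory Num.Theory.
Import numFieldNormedType.Exports.

Local Open Scope classical_set_scope.
Local Open Scope ring_scope.

(* [0,1] with the Lebesgue measure, realised as the restriction to [0,1] of the
   Lebesgue measure of the line: [Lfun mu01 q] is then L^q([0,1]), and the
   values of a function outside [0,1] are irrelevant. *)
Definition mu01 (R : realType) : {measure set (measurableTypeR R) -> \bar R} :=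
  mrestr (@lebesgue_measure R) (measurable_itv `[0, 1]).

(* Elements of [LfunType mu q1] are functions rather than classes modulo
   a.e. equality.  A functional that is bounded for the seminorm 'N[mu]_q is
   constant on these classes, so these are exactly the elements of (L^q)'. *)
Definition bounded_functional d (T : measurableType d) (R : realType)
    (mu : {measure set T -> \bar R}) (q : \bar R) (q1 : (1 <= q)%E)
    (phi : {scalar LfunType mu q1}) : Prop :=
  exists M : R, forall f : LfunType mu q1,
    (`|phi f|%:E <= M%:E * 'N[mu]_q[EFin \o f])%E.

(* f_ n converges weakly to f in L^q (which includes membership in L^q).
   For q < +oo, this is convergence against every element of (L^q)'.
   For q = +oo, it is the weak-* convergence of L^oo = (L^1)'. *)
Definition weak_cvg d (T : measurableType d) (R : realType)
    (mu : {measure set T -> \bar R}) (q : \bar R) (q1 : (1 <= q)%E)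
    (f_ : nat -> T -> R) (f : T -> R) : Prop :=
  exists (Lf_ : forall n, f_ n \in Lfun mu q) (Lf : f \in Lfun mu q),
    if q == +oo%E then
      forall g : T -> R, g \in Lfun mu 1 ->
        (\int[mu]_x (f_ n x * g x)%:E)%E @[n --> \oo] -->
        (\int[mu]_x (f x * g x)%:E)%E
    else
      forall phi : {scalar LfunType mu q1}, bounded_functional phi ->
        phi (Lfun_Sub q1 (Lf_ n)) @[n --> \oo] --> phi (Lfun_Sub q1 Lf).

(* a_ k >= b_ k + o(1) *)
Definition ge_o1 (R : realType) (a_ b_ : nat -> \bar R) : Prop :=
  exists eps : nat -> R,
    eps k @[k --> \oo] --> (0 : R) /\
    forall k, (b_ k + (eps k)%:E <= a_ k)%E.

(* Main.v *)
Require Import Defs.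
From HB Require Import structures.
From mathcomp Require Import all_boot all_order all_algebra.
From mathcomp Require Import all_classical all_reals all_analysis.
From mathcomp Require Import measurable_realfun ess_sup_inf ring lra.

Set Implicit Arguments.
Unset Strict Implicit.
Unset Printing Implicit Defensive.

Import Order.TTheory GRing.Theory Num.Theory.
Import numFieldNormedType.Exports.

Local Open Scope classical_set_scope.
Local Open Scope ring_scope.

(** The functions [v k] are identically distributed, bounded and pairwise
    orthogonal, so the three integrals in the relation do not depend on [k] and
    everything is decided by one probability law on the line.  That law, the
    law of a random variable [V], has to satisfy

      E V = 0,   E |V|^(p-2) V = 0,   E (|1+V|^p - |V|^p - 1) < 0.

    The last quantity is then the constant by which the relation fails, and the
    first two make [v k] and [|v k|^(p-2) v k] two bounded orthogonal sequences.

    The law ([three_point_law]).  It is carried by 1, -t and -1/t, with weights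
    proportional to t + t^(p-1), 1 and t^p.  This choice solves both moment
    equations at once, because the excess
    f(x) = |1+x|^p - |x|^p - 1 and the two moment functions are compatible with
    the inversion x -> 1/x; in particular t^p f(-1/t) = f(-t).  The expected
    excess is therefore proportional to (t + t^(p-1)) f(1) + 2 f(-t).  For p < 2
    it is negative at t = 1, where V = 1 or -1 with equal probabilities.  For
    2 < p < 3 it equals t (2^p - 2 - 2p) up to terms of higher order as t tends
    to 0, and 2^p < 2 + 2p for 2 < p < 3 ([excess_neg]).  The bracket vanishes at
    p = 3, which is where the range of exponents ends.

    The realisation on [0,1] ([mu01_branch3], [symbol_weak_cvg0]).  Cut [0,1] into
    intervals whose lengths are the weights and let S map each of them affinely
    onto [0,1].  S preserves the Lebesgue measure, and the index of the interval
    that contains x is independent of S x.  Hence the itinerary of x under S is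
    an independent sequence with the prescribed law, and [v k x] is the value
    attached to its k-th term.

    Weak convergence ([orthogonal_weak_cvg0]).  No description of the dual of
    L^q is used.  Let c_k be the values of a bounded functional on bounded
    orthogonal functions w_k.  By orthogonality, a signed average of n of the
    w_k has squared L^2 norm O(1/n); since it is also bounded, it is small in
    every L^q with q finite.  So the signed averages of the c_k are small, which
    is possible only if c_k tends to 0 ([signed_averages_cvg0]).  For the weak-*
    convergence in L^oo, an integrable test function is bounded up to an
    error that is small in L^1, and the L^1 norm of the averages suffices. *)

(** * Signed averages *)

(** If |c_k| >= eps for infinitely many k, then weighting exactly those k by the
    sign of c_k gives averages of size at least eps.  The weights [a] may be
    zero, which spares the choice of a subsequence: the sum of the |a k| plays
    the role of the number of averaged terms. *)
Lemma signed_averages_cvg0 (R : realType) (c : nat -> R) :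
  (forall eps : R, 0 < eps -> exists2 n0 : R, 0 < n0 &
     forall N (a : nat -> R), (forall k, `|a k| <= 1) ->
       n0 <= \sum_(0 <= k < N) `|a k| ->
       `|\sum_(0 <= k < N) a k * c k| <= eps * \sum_(0 <= k < N) `|a k|) ->
  c @ \oo --> (0 : R).
Proof.
move=> H; apply/cvgrPdist_lt => eps eps0.
have e20 : 0 < eps / 2 by rewrite divr_gt0.
have [n0 n0_gt0 Hn0] := H _ e20.
pose a k : R := if eps <= `|c k| then Num.sg (c k) else 0.
have a1 k : `|a k| <= 1.
  by rewrite /a; case: ifPn => _; rewrite ?normr0// normr_sg; case: (c k == 0).
have aE k : `|a k| = (eps <= `|c k|)%R%:R.
  rewrite /a; case: ifPn => ck; rewrite ?normr0// normr_sg.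
  by have -> : c k != 0 by rewrite -normr_gt0 (lt_le_trans eps0).
have acE k : eps * `|a k| <= a k * c k.
  rewrite aE /a; case: ifPn => ck; rewrite ?mulr1 ?mulr0 ?mul0r//.
  by rewrite -normrEsg.
have bnd N : \sum_(0 <= k < N) `|a k| < n0.
  rewrite ltNge; apply/negP => n0N.
  have s0 := lt_le_trans n0_gt0 n0N.
  have := Hn0 N a a1 n0N; apply/negP; rewrite -ltNge.
  apply: (lt_le_trans _ (ler_norm _)).
  apply: (@lt_le_trans _ _ (eps * \sum_(0 <= k < N) `|a k|)).
    by rewrite ltr_pM2r// ltr_pdivrMr// ltr_pMr// ltr1n.
  by rewrite mulr_sumr ler_sum.
(* The weights |a k| are 0 or 1 and summable, hence eventually 0. *)
have cvg_a : (fun k => `|a k|) @ \oo --> (0 : R).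
  apply: cvg_series_cvg_0.
  apply: nondecreasing_is_cvgn.
    by apply/nondecreasing_seqP => n; rewrite /series/= big_nat_recr//= lerDl.
  by exists n0 => _ [n _ <-]; apply: ltW; exact: bnd.
move/cvgrPdist_lt : cvg_a => /(_ 1 ltr01).
apply: filterS => k; rewrite !sub0r !normrN normr_id aE.
by case: (leP eps `|c k|) => _ //; rewrite mulr1n ltxx.
Qed.

(** * Bounded functions on a probability space *)

Lemma Rintegral_sum d (T : measurableType d) (R : realType)
    (mu : {measure set T -> \bar R}) (I : Type) (s : seq I) (F : I -> T -> R) :
  (forall i, mu.-integrable [set: T] (EFin \o F i)) ->
  \int[mu]_x (\sum_(i <- s) F i x) = \sum_(i <- s) \int[mu]_x F i x.
Proof.
move=> iF; rewrite /Rintegral.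
under eq_integral => x _ do rewrite -sumEFin.
rewrite (integral_sum measurableT iF) sum_fine// => i _.
exact: (integrable_fin_num measurableT (iF i)).
Qed.

Section bounded_functions.
Context d (T : measurableType d) (R : realType).
Variables (mu : {measure set T -> \bar R}).
Hypothesis mu1 : mu [set: T] = 1%E.

Lemma bounded_integrable (f : T -> R) (C : R) :
  measurable_fun [set: T] f -> (forall x, `|f x| <= C) ->
  mu.-integrable [set: T] (EFin \o f).
Proof.
move=> mf fC; apply: measurable_bounded_integrable => //.
- by rewrite [X in (X < _)%E]mu1 ltry.
- exists C; split; first exact: num_real.
  by move=> M CM x _; exact: le_trans (fC x) (ltW CM).
Qed.

Lemma integrable_cst1 (c : R) : mu.-integrable [set: T] (EFin \o (fun=> c)).
Proof. exact: (@bounded_integrable (fun=> c) `|c|). Qed.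

Lemma Rintegral_cst1 (c : R) : \int[mu]_x c = c.
Proof. by rewrite Rintegral_cst// [X in fine X]mu1 mulr1. Qed.

Lemma bounded_Lfun (f : T -> R) (C : R) (q : \bar R) : (1 <= q)%E ->
  measurable_fun [set: T] f -> (forall x, `|f x| <= C) -> f \in Lfun mu q.
Proof.
move=> q1 mf fC; rewrite inE; apply/andP; split; rewrite inE//= /finite_norm.
case: q q1 => [q||//]; rewrite ?lee_fin => q1; rewrite unlock /Lnorm.
- have q0 := lt_le_trans ltr01 q1.
  apply: poweR_lty.
  apply: (@le_lt_trans _ _ (\int[mu]_x (cst (C `^ q)%:E x))%E).
    apply: ge0_le_integral => //.
    + by move=> x _; rewrite lee_fin powR_ge0.
    + apply/measurable_EFinP.
      apply: (measurableT_comp (measurable_powR _)) => //.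
      exact: measurableT_comp.
    + by move=> x _; rewrite lee_fin ge0_ler_powR ?nnegrE ?(ltW q0)// (le_trans _ (fC x)).
  by rewrite integral_cst// [X in (_ * X)%E]mu1 mule1 ltry.
- rewrite mu1 lte01; apply: (@le_lt_trans _ _ C%:E); last exact: ltry.
  by apply/ess_supP/nearW => x /=; rewrite lee_fin.
Qed.

End bounded_functions.

(** * Averages of bounded orthogonal functions *)

Section bounded_orthogonal.
Context d (T : measurableType d) (R : realType).
Variables (mu : {measure set T -> \bar R}).
Hypothesis mu1 : mu [set: T] = 1%E.
Variables (w : nat -> T -> R) (C : R).
Hypothesis mw : forall k, measurable_fun [set: T] (w k).
Hypothesis wC : forall k x, `|w k x| <= C.
Hypothesis w_orth : forall j k, (j < k)%N -> \int[mu]_x (w j x * w k x) = 0.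

Let comb (a : nat -> R) (N : nat) (x : T) : R := \sum_(0 <= k < N) a k * w k x.

Let C0 : 0 <= C.
Proof.
have [x _] : [set: T] !=set0.
  apply/set0P/eqP => T0; move: mu1; rewrite T0 measure0 => /eqP.
  by rewrite eqe eq_sym oner_eq0.
exact: le_trans (normr_ge0 _) (wC 0 x).
Qed.

Let comb0 a : comb a 0 = cst 0.
Proof. by apply/funext => x; rewrite /comb big_geq. Qed.

Let combS a N : comb a N.+1 = comb a N \+ a N \o* w N.
Proof. by apply/funext => x; rewrite /comb big_nat_recr//= [w N x * _]mulrC. Qed.

Let measurable_comb a N : measurable_fun [set: T] (comb a N).
Proof.
elim: N => [|N IH]; first by rewrite comb0.
by rewrite combS; apply: measurable_funD => //; exact: measurable_funM.
Qed.

Let comb_le a N x : (forall k, `|a k| <= 1) ->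
  `|comb a N x| <= C * \sum_(0 <= k < N) `|a k|.
Proof.
move=> a1; rewrite mulr_sumr; apply: le_trans (ler_norm_sum _ _ _) _.
by apply: ler_sum => k _; rewrite normrM mulrC ler_wpM2r.
Qed.

Let integrable_comb_mul a N M : (forall k, `|a k| <= 1) ->
  mu.-integrable [set: T] (EFin \o (fun x => comb a N x * w M x)).
Proof.
move=> a1; apply: (@bounded_integrable _ _ _ _ mu1 _ ((C * \sum_(0 <= k < N) `|a k|) * C)).
  exact: measurable_funM.
by move=> x; rewrite normrM ler_pM// comb_le.
Qed.

Let integrable_w_mul j k :
  mu.-integrable [set: T] (EFin \o (fun x => w j x * w k x)).
Proof.
apply: (@bounded_integrable _ _ _ _ mu1 _ (C * C)); first exact: measurable_funM.
by move=> x; rewrite normrM ler_pM.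
Qed.

Let comb_orth a N M : (forall k, `|a k| <= 1) -> (N <= M)%N ->
  \int[mu]_x (comb a N x * w M x) = 0.
Proof.
move=> a1; elim: N => [|N IH] NM.
  by under eq_Rintegral do rewrite comb0 mul0r; rewrite Rintegral_cst1.
under eq_Rintegral => x _.
  rewrite combS /= mulrDl [w N x * a N]mulrC -mulrA; over.
rewrite RintegralD//; [|exact: integrable_comb_mul|].
  by rewrite IH ?(ltnW NM)// RintegralZl// w_orth// mulr0 addr0.
by apply: (@integrableZl _ _ _ mu _ measurableT (a N) (EFin \o (fun x => w N x * w M x))).
Qed.

(** Pythagoras; the bound is linear in the weights because a^2 <= |a|. *)
Let integral_comb_sqr_le a N : (forall k, `|a k| <= 1) ->
  \int[mu]_x (comb a N x ^+ 2) <= C ^+ 2 * \sum_(0 <= k < N) `|a k|.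
Proof.
move=> a1; elim: N => [|N IH].
  rewrite big_geq// mulr0.
  by under eq_Rintegral do rewrite comb0 expr0n; rewrite Rintegral_cst1.
have icomb n : mu.-integrable [set: T] (EFin \o (fun x => comb a n x ^+ 2)).
  apply: (@bounded_integrable _ _ _ _ mu1 _ ((C * \sum_(0 <= k < n) `|a k|) ^+ 2)).
    exact: measurable_funX.
  by move=> x; rewrite normrX lerXn2r ?nnegrE ?comb_le// (le_trans _ (comb_le n x a1)).
rewrite big_nat_recr//= mulrDr.
have -> : (fun x => comb a N.+1 x ^+ 2) =
    (fun x => comb a N x ^+ 2 + (2 * a N * (comb a N x * w N x) +
       a N ^+ 2 * (w N x * w N x))).
  by apply/funext => x; rewrite combS /=; ring.
have i1 := integrableZl measurableT (2 * a N) (integrable_comb_mul N N a1).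
have i2 := integrableZl measurableT (a N ^+ 2) (integrable_w_mul N N).
rewrite RintegralD//; last exact: integrableD i1 i2.
apply: lerD => //.
rewrite RintegralD// RintegralZl//; last exact: integrable_comb_mul.
rewrite comb_orth// mulr0 add0r RintegralZl//.
apply: (@le_trans _ _ (`|a N| * C ^+ 2)); last by rewrite mulrC.
apply: ler_pM => //.
- by rewrite sqr_ge0.
- by apply: Rintegral_ge0 => x _; rewrite -expr2 sqr_ge0.
- by rewrite -[a N ^+ 2]real_normK ?num_real// expr2 ler_piMl.
rewrite -[leRHS](Rintegral_cst1 mu1); apply: le_Rintegral => //.
- exact: integrable_cst1.
- by move=> x _; rewrite -expr2 -real_normK ?num_real// lerXn2r ?nnegrE.
Qed.

(** Orthogonality controls only the L^2 norm.  A bound C on the average A turns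
    it into an L^q bound for every q > 0, above or below 2, through the pointwise
    inequality |A|^q <= e^q + (C^q / e^2) A^2. *)
Lemma signed_average_Lq (q eps : R) : 0 < q -> 0 < eps ->
  exists2 n0 : R, 0 < n0 & forall N (a : nat -> R), (forall k, `|a k| <= 1) ->
    n0 <= \sum_(0 <= k < N) `|a k| ->
    \int[mu]_x (`|(\sum_(0 <= k < N) `|a k|)^-1 * comb a N x| `^ q) <= eps.
Proof.
move=> q0 eps0.
pose e := (eps / 2) `^ q^-1.
have e2 : 0 < eps / 2 by rewrite divr_gt0.
have e0 : 0 < e by rewrite powR_gt0.
have eq_ : e `^ q = eps / 2 by rewrite -powRrM mulVf ?gt_eqF// powRr1// ltW.
pose K := C `^ q * (e ^+ 2)^-1.
have K0 : 0 <= K by rewrite mulr_ge0 ?powR_ge0// invr_ge0 sqr_ge0.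
have n0_gt0 : 0 < 1 + 2 * K * C ^+ 2 / eps.
  by rewrite ltr_pwDl// divr_ge0 ?(ltW eps0)// mulr_ge0 ?sqr_ge0// mulr_ge0.
(* With s the sum of the weights, the integral is at most e^q + K C^2 / s,
   and e^q = eps / 2. *)
exists (1 + 2 * K * C ^+ 2 / eps) => //.
move=> N a a1; set s := \sum_(0 <= k < N) `|a k| => n0s.
have s0 : 0 < s := lt_le_trans n0_gt0 n0s.
have AC x : `|s^-1 * comb a N x| <= C.
  rewrite normrM gtr0_norm ?invr_gt0// mulrC ler_pdivrMr//; exact: comb_le.
have isq : mu.-integrable [set: T] (EFin \o (fun x => comb a N x ^+ 2)).
  apply: (@bounded_integrable _ _ _ _ mu1 _ ((C * s) ^+ 2)).
    exact: measurable_funX.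
  by move=> x; rewrite normrX lerXn2r ?nnegrE ?comb_le// mulr_ge0// ltW.
apply: (@le_trans _ _ (\int[mu]_x (eps / 2 + K * (s ^+ 2)^-1 * comb a N x ^+ 2))).
  apply: le_Rintegral => //.
  - apply: (@bounded_integrable _ _ _ _ mu1 _ (C `^ q)).
      apply: (measurableT_comp (measurable_powR _)) => //.
      apply: measurableT_comp => //; exact: measurable_funM.
    move=> x; rewrite ger0_norm ?powR_ge0//.
    by rewrite ge0_ler_powR ?nnegrE// ltW.
  - exact: (integrableD measurableT (integrable_cst1 mu1 (eps / 2))
      (integrableZl measurableT (K * (s ^+ 2)^-1) isq)).
  - move=> x _.
    have -> : K * (s ^+ 2)^-1 * comb a N x ^+ 2 = K * `|s^-1 * comb a N x| ^+ 2.
      by rewrite real_normK ?num_real// -mulrA -exprVn -exprMn.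
    move: (AC x); set A := `|_| => AC'; have A0 : 0 <= A by exact: normr_ge0.
    have [Ae|eA] := leP A e.
      apply: (@le_trans _ _ (e `^ q)); last by rewrite eq_ lerDl mulr_ge0 ?sqr_ge0.
      by rewrite ge0_ler_powR ?nnegrE// ltW.
    apply: (@le_trans _ _ (C `^ q)).
      by rewrite ge0_ler_powR ?nnegrE// ltW.
    apply: (@le_trans _ _ (K * A ^+ 2)); last by rewrite lerDr ltW.
    rewrite /K -mulrA ler_peMr ?powR_ge0// mulrC ler_pdivlMr ?exprn_gt0// mul1r.
    by rewrite lerXn2r ?nnegrE// ltW.
rewrite RintegralD//; last 2 first.
- exact: integrable_cst1.
- exact: (integrableZl measurableT _ isq).
rewrite Rintegral_cst1// RintegralZl//.
apply: (@le_trans _ _ (eps / 2 + K * (s ^+ 2)^-1 * (C ^+ 2 * s))).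
  rewrite lerD2l ler_wpM2l ?integral_comb_sqr_le//.
  by rewrite mulr_ge0// invr_ge0 sqr_ge0.
rewrite [leRHS]splitr lerD2l.
have -> : K * (s ^+ 2)^-1 * (C ^+ 2 * s) = K * C ^+ 2 / s.
  by field; rewrite gt_eqF.
rewrite ler_pdivrMr//.
apply: le_trans (ler_wpM2l (ltW e2) n0s).
have -> : eps / 2 * (1 + 2 * K * C ^+ 2 / eps) = eps / 2 + K * C ^+ 2.
  by field; rewrite gt_eqF.
by rewrite lerDr ltW.
Qed.

End bounded_orthogonal.

(** * Weak convergence of bounded orthogonal sequences *)

Lemma integrable_tail d (T : measurableType d) (R : realType)
    (mu : {measure set T -> \bar R}) (g : T -> R) (eps : R) :
  mu.-integrable [set: T] (EFin \o g) -> 0 < eps ->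
  exists2 K : R, 0 <= K &
    (\int[mu]_x (if K < `|g x| then `|g x| else 0) <= eps)
    /\ mu.-integrable [set: T] (EFin \o (fun x => if K < `|g x| then `|g x| else 0)).
Proof.
move=> ig eps0.
have mg : measurable_fun [set: T] g by apply/measurable_EFinP; exact: measurable_int ig.
pose f_ (n : nat) x : R := if n%:R < `|g x| then `|g x| else 0.
have mf_ n : measurable_fun [set: T] (f_ n).
  apply: measurable_fun_ifT => //; last exact: measurableT_comp.
  by apply: measurable_fun_ltr => //; exact: measurableT_comp.
have f_g n x : `|f_ n x| <= `|g x| by rewrite /f_; case: ifP; rewrite ?normr_id ?normr0.
have if_ n : mu.-integrable [set: T] (EFin \o f_ n).
  apply: (le_integrable measurableT _ _ (integrable_norm ig)).
    exact/measurable_EFinP.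
  by move=> x _ /=; rewrite lee_fin normr_id.
have /cvgrPdist_le /(_ _ eps0) [n _ Hn] :
    (fun n => \int[mu]_x (f_ n x)) @ \oo --> (0 : R).
  have dc : (\int[mu]_x (f_ n x)%:E)%E @[n --> \oo] --> (\int[mu]_x (cst 0 x))%E.
    apply: (@dominated_cvg _ _ _ mu setT measurableT (fun n => EFin \o f_ n)
              (cst 0%E) (EFin \o (fun x => `|g x|))).
    - by move=> n; exact/measurable_EFinP.
    - move=> x _; apply: cvg_near_cst; exists (Num.bound `|g x|) => // n /= gn.
      rewrite /f_ ltNge; have -> // : `|g x| <= n%:R.
      apply: (@le_trans _ _ (Num.bound `|g x|)%:R); last by rewrite ler_nat.
      exact/ltW/archi_boundP.
    - by [].
    - exact: integrable_norm.
    - by move=> n x _ /=; rewrite lee_fin.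
  by rewrite integral0 in dc; exact: (fine_cvg dc).
exists n%:R => //; split; last exact: if_.
have := Hn n (leqnn n); rewrite sub0r normrN; apply: le_trans; exact: ler_norm.
Qed.

Section weak_convergence.
Context d (T : measurableType d) (R : realType).
Variables (mu : {measure set T -> \bar R}).
Hypothesis mu1 : mu [set: T] = 1%E.
Variables (w : nat -> T -> R) (C : R).
Hypothesis mw : forall k, measurable_fun [set: T] (w k).
Hypothesis wC : forall k x, `|w k x| <= C.
Hypothesis w_orth : forall j k, (j < k)%N -> \int[mu]_x (w j x * w k x) = 0.

Lemma orthogonal_functional_cvg0 (q : R) (q1 : (1 <= q%:E)%E)
    (Lw : forall n, w n \in Lfun mu q%:E) (phi : {scalar LfunType mu q1}) :
  bounded_functional phi -> phi (Lfun_Sub q1 (Lw n)) @[n --> \oo] --> (0 : R).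
Proof.
move=> [M phiM]; have q0 : 0 < q by rewrite (lt_le_trans ltr01).
apply: signed_averages_cvg0 => eps eps0.
pose M' := `|M| + 1; have M'0 : 0 < M' by rewrite ltr_wpDl.
have e0 : 0 < (eps / M') `^ q by rewrite powR_gt0// divr_gt0.
have [n0 n0_gt0 Hn0] := signed_average_Lq mu1 mw wC w_orth q0 e0.
exists n0 => // N a a1 n0s; have := Hn0 N a a1 n0s.
move: (lt_le_trans n0_gt0 n0s); set s := \sum_(0 <= k < N) `|a k| => s0 leA.
pose A : LfunType mu q1 := s^-1 *: \sum_(0 <= k < N) a k *: Lfun_Sub q1 (Lw k).
have AE : (A : T -> R) = (fun x => s^-1 * \sum_(0 <= k < N) a k * w k x).
  have -> : (A : T -> R) = (fun x => s^-1 *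
      (\sum_(0 <= k < N) a k *: Lfun_Sub q1 (Lw k) : LfunType mu q1) x) by [].
  apply/funext => x; congr (_ * _).
  elim: N {a1 n0s s s0 leA A} => [|N IH]; first by rewrite !big_geq.
  by rewrite !big_nat_recr//= -IH.
have -> : \sum_(0 <= k < N) a k * phi (Lfun_Sub q1 (Lw k)) = s * phi A.
  rewrite /A linearZ/= mulrA mulfV ?gt_eqF// mul1r linear_sum/=.
  by apply: eq_bigr => k _; rewrite linearZ.
rewrite normrM gtr0_norm// mulrC ler_wpM2r ?(ltW s0)//.
have normA : ('N[mu]_q%:E[EFin \o A] <= (eps / M')%:E)%E.
  rewrite unlock /Lnorm.
  have iA : (\int[mu]_x `|(EFin \o A) x| `^ q <= ((eps / M') `^ q)%:E)%E.
    have fA : (\int[mu]_x (`|A x| `^ q)%:E)%E \is a fin_num.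
      apply: integrable_fin_num => //.
      by apply: (@Lfun_integrable _ _ _ mu A q) => //; exact: LfunP.
    rewrite -[leLHS](fineK fA) lee_fin.
    suff -> : fine (\int[mu]_x (`|A x| `^ q)%:E)%E =
      \int[mu]_x `|s^-1 * \sum_(0 <= k < N) a k * w k x| `^ q by [].
    by apply: eq_Rintegral => x _; rewrite AE.
  apply: (@le_trans _ _ (((eps / M') `^ q)%:E `^ q^-1)%E).
    apply: gt0_ler_poweR => //.
    - by rewrite invr_ge0 ltW.
    - by rewrite in_itv/= leey integral_ge0.
    - by rewrite in_itv/= leey lee_fin powR_ge0.
  by rewrite poweR_EFin -powRrM mulfV ?gt_eqF// powRr1// ltW// divr_gt0.
have := phiM A; rewrite -lee_fin => /le_trans; apply.
apply: (@le_trans _ _ (M'%:E * 'N[mu]_q%:E[EFin \o A])%E).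
  apply: lee_wpmul2r; first exact: Lnorm_ge0.
  by rewrite lee_fin (le_trans (ler_norm _))// lerDl.
apply: le_trans (lee_wpmul2l _ normA) _; first by rewrite lee_fin ltW.
by rewrite -EFinM lee_fin mulrC divfK// gt_eqF.
Qed.

(** Pairing with an integrable g is not bounded for any L^q norm with q finite.
    Splitting g at a level K repairs this: the part above K has small L^1 norm
    and meets averages bounded by C, the part below K is bounded and meets
    averages of small L^1 norm. *)
Lemma orthogonal_integral_cvg0 (g : T -> R) : g \in Lfun mu 1 ->
  \int[mu]_x (w n x * g x) @[n --> \oo] --> (0 : R).
Proof.
move=> /Lfun1_integrable ig.
have mg : measurable_fun [set: T] g by apply/measurable_EFinP; exact: measurable_int ig.
have C0 : 0 <= `|C| + 1 by rewrite addr_ge0.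
have Cgt0 : 0 < `|C| + 1 by rewrite ltr_wpDl.
apply: signed_averages_cvg0 => eps eps0.
have e0 : 0 < eps / 2 / (`|C| + 1) by rewrite !divr_gt0.
have [K K0 [tailK itailK]] := integrable_tail ig e0.
have K1 : 0 < K + 1 by rewrite ltr_wpDl.
have e1 : 0 < eps / 2 / (K + 1) by rewrite !divr_gt0.
have [n0 n0_gt0 Hn0] := signed_average_Lq mu1 mw wC w_orth ltr01 e1.
exists n0 => // N a a1 n0s; have := Hn0 N a a1 n0s.
move: (lt_le_trans n0_gt0 n0s); set s := \sum_(0 <= k < N) `|a k| => s0.
pose A x := s^-1 * \sum_(0 <= k < N) a k * w k x.
(* The case q = 1 of [signed_average_Lq]. *)
rewrite -[X in Rintegral _ _ X]/(fun x => `|A x| `^ 1).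
under eq_Rintegral do rewrite powRr1//.
move=> leA.
have mA : measurable_fun [set: T] A.
  apply: measurable_funM => //; apply: measurable_sum => k.
  exact: measurable_funM.
have AC x : `|A x| <= `|C| + 1.
  rewrite /A normrM gtr0_norm ?invr_gt0// mulrC ler_pdivrMr// mulr_sumr.
  apply: le_trans (ler_norm_sum _ _ _) _; apply: ler_sum => k _.
  rewrite normrM mulrC ler_wpM2r// (le_trans (wC _ _))// (le_trans (ler_norm _))//.
  by rewrite lerDl.
have iwg k : mu.-integrable [set: T] (EFin \o (fun x => w k x * g x)).
  apply: (le_integrable measurableT _ _ (integrableZl measurableT C ig)).
    by apply/measurable_EFinP; exact: measurable_funM.
  move=> x _ /=; rewrite lee_fin !normrM ler_wpM2r//.
  exact: le_trans (wC _ _) (ler_norm _).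
have iA : mu.-integrable [set: T] (EFin \o A) by exact: bounded_integrable mA AC.
have iAg : mu.-integrable [set: T] (EFin \o (fun x => A x * g x)).
  apply: (le_integrable measurableT _ _ (integrableZl measurableT (`|C| + 1) ig)).
    by apply/measurable_EFinP; exact: measurable_funM.
  move=> x _ /=; rewrite lee_fin (normrM (A x) (g x)) (normrM (`|C| + 1) (g x)) ler_wpM2r//.
  exact: le_trans (AC _) (ler_norm _).
have -> : \sum_(0 <= k < N) a k * \int[mu]_x (w k x * g x) =
    s * \int[mu]_x (A x * g x).
  rewrite -RintegralZl//.
  under [RHS]eq_Rintegral => x _ do
    rewrite /A !mulrA mulfV ?gt_eqF// mul1r mulr_suml.
  rewrite Rintegral_sum; last first.
    move=> k.
    apply: eq_integrable (integrableZl measurableT (a k) (iwg k)) => // x _ /=.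
    by rewrite -EFinM mulrA.
  apply: eq_bigr => k _; rewrite -RintegralZl//.
  by apply: eq_Rintegral => x _; rewrite mulrA.
rewrite normrM gtr0_norm// mulrC ler_wpM2r ?(ltW s0)//.
apply: le_trans (le_normr_Rintegral measurableT iAg) _.
pose t x : R := if K < `|g x| then `|g x| else 0.
have i1 := integrableZl measurableT (`|C| + 1) itailK.
have i2 := integrableZl measurableT (K + 1) (integrable_norm iA).
apply: (@le_trans _ _ (\int[mu]_x ((`|C| + 1) * t x + (K + 1) * `|A x|))).
  apply: le_Rintegral => //.
  - exact: integrable_norm iAg.
  - exact: (integrableD measurableT i1 i2).
  - move=> x _; rewrite normrM /t; case: ltP => gK.
      apply: (@le_trans _ _ ((`|C| + 1) * `|g x|)); first by rewrite ler_wpM2r.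
      by rewrite lerDl mulr_ge0// ltW.
    rewrite mulr0 add0r mulrC ler_wpM2r// (le_trans gK)// lerDl.
  by [].
rewrite RintegralD// (RintegralZl _ measurableT itailK).
rewrite (RintegralZl _ measurableT (integrable_norm iA)).
rewrite [leRHS]splitr; apply: lerD.
  apply: le_trans (ler_wpM2l C0 tailK) _.
  by rewrite mulrC divfK// gt_eqF.
apply: le_trans (ler_wpM2l (ltW K1) leA) _.
by rewrite mulrC divfK// gt_eqF.
Qed.

Theorem orthogonal_weak_cvg0 (q : \bar R) (q1 : (1 <= q)%E) :
  weak_cvg mu q1 w (cst 0).
Proof.
have L0 : (cst 0 : T -> R) \in Lfun mu q.
  by apply: (@bounded_Lfun _ _ _ _ mu1 _ 0) => // x; rewrite normr0.
exists (fun n => bounded_Lfun mu1 q1 (mw n) (wC n)), L0.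
case: q q1 L0 => [q||//] q1 L0.
- move=> phi bphi.
  have -> : Lfun_Sub q1 L0 = 0 by apply/LfuneqP.
  rewrite linear0; exact: orthogonal_functional_cvg0.
- move=> g Lg.
  under [X in _ --> X]eq_integral do rewrite /= mul0r.
  rewrite integral0.
  have /Lfun1_integrable ig := Lg.
  apply: cvg_EFin; last exact: orthogonal_integral_cvg0.
  apply: nearW => n; apply: integrable_fin_num => //.
  apply: (le_integrable measurableT _ _ (integrableZl measurableT C ig)).
    apply/measurable_EFinP; apply: measurable_funM => //.
    by apply/measurable_EFinP; exact: measurable_int ig.
  move=> x _ /=; rewrite lee_fin !normrM ler_wpM2r//.
  exact: le_trans (wC _ _) (ler_norm _).
Qed.

End weak_convergence.

(** * Itineraries of a measure-preserving map with full branches *)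

(** In probabilistic terms, the last hypothesis says that the current symbol
    [branch x] is independent of the next point [S x], that the symbol [i] has
    probability [m i], and, after summation over [i], that [S] preserves [mu]. *)
Section full_branch.
Context d (T : measurableType d) (R : realType).
Variables (mu : {measure set T -> \bar R}).
Hypothesis mu1 : mu [set: T] = 1%E.
Variables (I : finType) (branch : T -> I) (m : I -> R) (S : T -> T).
Hypothesis mbranch : forall i, measurable (branch @^-1` [set i]).
Hypothesis mS : measurable_fun [set: T] S.
Hypothesis m0 : forall i, 0 <= m i.
Hypothesis branchS : forall i A, measurable A ->
  mu (branch @^-1` [set i] `&` S @^-1` A) = ((m i)%:E * mu A)%E.

Lemma ge0_integral_branch i (g : T -> \bar R) :
  measurable_fun [set: T] g -> (forall x, 0 <= g x)%E ->
  (\int[mu]_(x in branch @^-1` [set i]) g (S x) = (m i)%:E * \int[mu]_x g x)%E.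
Proof.
move=> mg g0; set B := branch @^-1` [set i].
have mB : measurable B by exact: mbranch.
have mgS : measurable_fun [set: T] (g \o S) by exact: measurableT_comp.
transitivity (\int[mrestr mu mB]_(x in B) (g \o S) x)%E.
  by apply: eq_measure_integral => A mA AB; rewrite /= /mrestr setIidl.
have -> : (\int[mrestr mu mB]_(x in B) (g \o S) x =
           \int[mrestr mu mB]_x (g \o S) x)%E.
  rewrite [RHS](@ge0_negligible_integral _ _ _ _ setT (~` B))//.
  - by rewrite setTD setCK.
  - exact: measurableC.
  - by move=> x _; exact: g0.
  - by rewrite /= /mrestr setICl measure0.
rewrite -[LHS](@ge0_integral_pushforward _ _ _ _ _ _ mS _ setT)//.
transitivity (\int[mscale (NngNum (m0 i)) mu]_x g x)%E.
  apply: eq_measure_integral => A mA _ /=.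
  by rewrite /pushforward /mscale/= /mrestr setIC; exact: branchS.
by rewrite ge0_integral_mscale.
Qed.

Lemma Rintegral_branch i (g : T -> R) :
  measurable_fun [set: T] g -> mu.-integrable [set: T] (EFin \o g) ->
  \int[mu]_(x in branch @^-1` [set i]) g (S x) = m i * \int[mu]_x g x.
Proof.
move=> mg ig; rewrite /Rintegral.
have /measurable_EFinP mEg := mg.
suff -> : (\int[mu]_(x in branch @^-1` [set i]) (g (S x))%:E =
    (m i)%:E * \int[mu]_x (g x)%:E)%E.
  by rewrite fineM// integrable_fin_num.
rewrite integralE [in RHS]integralE.
transitivity (\int[mu]_(x in branch @^-1` [set i]) (EFin \o g)^\+ (S x) -
              \int[mu]_(x in branch @^-1` [set i]) (EFin \o g)^\- (S x))%E.
  by congr (_ - _)%E; apply: eq_integral => x _; rewrite !unlock.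
rewrite !ge0_integral_branch//; last 2 first.
- exact: measurable_funeneg.
- exact: measurable_funepos.
rewrite [in RHS]muleBr//; apply: fin_num_adde_defr.
exact: integrable_pos_fin_num.
Qed.

(** This product formula is the independence of [branch x] and [S x] in integral
    form; the law, the invariance and the orthogonality below follow from it. *)
Lemma Rintegral_branch_mul (C : R) (e : I -> R) (g : T -> R) :
  measurable_fun [set: T] g -> (forall x, `|g x| <= C) ->
  \int[mu]_x (e (branch x) * g (S x)) = (\sum_i m i * e i) * \int[mu]_x g x.
Proof.
move=> mg gC; have ig := bounded_integrable mu1 mg gC.
have mgS : measurable_fun [set: T] (g \o S) by exact: measurableT_comp.
have igS := bounded_integrable mu1 mgS (fun x => gC (S x)).
pose F i x := e i * ((g \o S) \_ (branch @^-1` [set i])) x.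
have iF i : mu.-integrable [set: T] (EFin \o ((g \o S) \_ (branch @^-1` [set i]))).
  have := igS.
  move=> /(integrableS measurableT (mbranch i) (@subsetT _ _)).
  by move=> /(integrable_mkcond _ (mbranch i)); rewrite restrict_EFin.
transitivity (\int[mu]_x (\sum_i F i x)).
  apply: eq_Rintegral => x _; rewrite (bigD1 (branch x))//= big1 ?addr0.
    by rewrite /F patchE mem_set.
  move=> i ib; rewrite /F patchE memNset ?mulr0// => /esym/eqP.
  by rewrite (negbTE ib).
rewrite Rintegral_sum; last by move=> i; exact: (integrableZl measurableT (e i) (iF i)).
rewrite mulr_suml; apply: eq_bigr => i _.
rewrite (RintegralZl _ measurableT (iF i)) -Rintegral_mkcond.
by rewrite Rintegral_branch// mulrCA mulrA.
Qed.

Let symbol_le (e : I -> R) i : `|e i| <= \sum_j `|e j|.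
Proof. by rewrite (bigD1 i)//= lerDl sumr_ge0. Qed.

Lemma measurable_symbol (e : I -> R) k :
  measurable_fun [set: T] (fun x => e (branch (iter k S x))).
Proof.
have mSk : measurable_fun [set: T] (iter k S).
  elim: k => [|k IH]; first exact: measurable_id.
  by rewrite (_ : iter _ _ = S \o iter k S)//; exact: measurableT_comp.
rewrite (_ : (fun _ => _) = (fun x => \sum_i e i * \1_(branch @^-1` [set i]) x) \o iter k S).
  apply: measurableT_comp mSk; apply: measurable_sum => i.
  exact: measurable_funM.
apply/funext => x /=; set y := iter k S x.
rewrite (bigD1 (branch y))//= big1 ?addr0.
  by rewrite indicE mem_set// mulr1.
move=> i ib; rewrite indicE memNset ?mulr0// => /esym/eqP.
by rewrite (negbTE ib).
Qed.

Let sum_m : \sum_i m i = 1.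
Proof.
have one_le (x : T) : `|cst 1 x : R| <= 1 by rewrite normr1.
transitivity ((\sum_i m i * 1) * \int[mu]_x (cst 1 x)).
  by rewrite Rintegral_cst1// mulr1; apply: eq_bigr => i _; rewrite mulr1.
rewrite -(Rintegral_branch_mul (fun=> 1) (measurable_cst (1 : R)) one_le).
by under eq_Rintegral do rewrite mulr1; rewrite Rintegral_cst1.
Qed.

Let invariance C (g : T -> R) :
  measurable_fun [set: T] g -> (forall x, `|g x| <= C) ->
  \int[mu]_x g (S x) = \int[mu]_x g x.
Proof.
move=> mg gC; have := Rintegral_branch_mul (fun=> 1) mg gC.
under eq_Rintegral do rewrite mul1r.
by under eq_bigr do rewrite mulr1; rewrite sum_m mul1r.
Qed.

Lemma Rintegral_symbol (e : I -> R) k :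
  \int[mu]_x e (branch (iter k S x)) = \sum_i m i * e i.
Proof.
elim: k => [|k IH].
  have := @Rintegral_branch_mul 1 e (fun=> 1) (measurable_cst _) _.
  under eq_Rintegral do rewrite mulr1.
  by rewrite Rintegral_cst1// mulr1 => ->// _; rewrite normr1.
under eq_Rintegral do rewrite iterSr.
rewrite (invariance (C := \sum_j `|e j|) (g := fun x => e (branch (iter k S x))))//.
exact: measurable_symbol.
Qed.

Lemma integral_symbol (e : I -> R) k :
  (\int[mu]_x (e (branch (iter k S x)))%:E = (\sum_i m i * e i)%:E)%E.
Proof.
rewrite -(Rintegral_symbol e k) fineK//; apply: integrable_fin_num => //.
exact: (bounded_integrable mu1 (measurable_symbol e k)
  (fun x => symbol_le e (branch (iter k S x)))).
Qed.

(** By invariance one may take j = 0; then the k-th symbol is a function of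
    [S x], hence independent of the current symbol, whose value has mean 0. *)
Lemma symbol_orthogonal (e : I -> R) j k : (j < k)%N ->
  \sum_i m i * e i = 0 ->
  \int[mu]_x (e (branch (iter j S x)) * e (branch (iter k S x))) = 0.
Proof.
move=> + e0; elim: j k => [|j IH] [//|k] jk.
  under eq_Rintegral do rewrite iterSr.
  rewrite (@Rintegral_branch_mul (\sum_j `|e j|) e (fun x => e (branch (iter k S x))))//.
    by rewrite e0 mul0r.
  exact: measurable_symbol.
under eq_Rintegral do rewrite !iterSr.
rewrite (invariance (C := (\sum_j `|e j|) * (\sum_j `|e j|))
  (g := fun x => e (branch (iter j S x)) * e (branch (iter k S x)))).
- exact: IH.
- by apply: measurable_funM; exact: measurable_symbol.
- by move=> x; rewrite normrM ler_pM.
Qed.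

Theorem symbol_weak_cvg0 (e : I -> R) (q : \bar R) (q1 : (1 <= q)%E) :
  \sum_i m i * e i = 0 ->
  weak_cvg mu q1 (fun k x => e (branch (iter k S x))) (cst 0).
Proof.
move=> e0; apply: (@orthogonal_weak_cvg0 _ _ _ _ mu1 _ (\sum_j `|e j|)) => //.
- by move=> k; exact: measurable_symbol.
- by move=> j k jk; exact: symbol_orthogonal.
Qed.

End full_branch.

(** * A three-branch map of the unit interval *)

(** The Lebesgue measure of the line is determined by its values on the intervals
    ]x, y], for which the formula is a computation. *)
Lemma lebesgue_measure_affine (R : realType) (s l : R) (A : set R) :
  0 < l -> measurable A ->
  lebesgue_measure ((fun x => (x - s) / l) @^-1` A) =
  (l%:E * lebesgue_measure A)%E.
Proof.
move=> l0 mA; pose phi x : measurableTypeR R := (x - s) / l.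
have mphi : measurable_fun [set: measurableTypeR R] phi.
  by apply: measurable_funM => //; exact: measurable_funB.
have li0 : 0 <= l^-1 by rewrite invr_ge0 ltW.
pose nu : {measure set (measurableTypeR R) -> \bar R} :=
  pushforward (@lebesgue_measure R) phi.
pose nul : {measure set (measurableTypeR R) -> \bar R} := mscale (NngNum li0) (nu mphi).
have H : lebesgue_measure A = nul A.
  apply: (@lebesgue_measure_unique R nul) => // _ [[x y]] _ <- /=.
  rewrite /nul /mscale /nu /= /pushforward.
  have -> : phi @^-1` `]x, y]%classic = `](l * x + s), (l * y + s)]%classic.
    apply/seteqP; split => t /=; rewrite !in_itv/= /phi ltr_pdivlMr// ler_pdivrMr//;
      rewrite ltrBrDr lerBlDr ![_ * l]mulrC//.
  rewrite !lebesgue_measure_itv/= !lte_fin ltrD2r ltr_pM2l//.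
  case: ifP => _; last by rewrite mule0.
  rewrite -!EFinB -EFinM; congr EFin; field; exact: lt0r_neq0.
by rewrite H /mscale/= /pushforward/= muleA -EFinM mulfV ?gt_eqF// mul1e.
Qed.

(** With the point 1 removed, the unit interval is cut into three half-open
    intervals of the same shape, each of which [map3] sends onto the whole. *)
Lemma mu01E (R : realType) (A : set R) : measurable A ->
  mu01 R A = lebesgue_measure (A `&` `[0, 1[).
Proof.
move=> mA; rewrite /mu01 /= /mrestr.
rewrite (_ : `[0, 1]%classic = `[0, 1[ `|` [set 1]); last first.
  by rewrite setUitv1// bnd_simp.
rewrite setIUr; apply: measureU0.
1,2: exact: measurableI.
apply: (@subset_measure0 _ _ _ (@lebesgue_measure R) _ [set (1 : R)]).
- exact: measurableI.
- exact: measurable_set1.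
- by move=> x [].
- exact: lebesgue_measure_set1.
Qed.

Lemma mu01_setT (R : realType) : mu01 R [set: R] = 1%E.
Proof.
rewrite mu01E// setTI lebesgue_measure_itv/= lte_fin ltr01.
by rewrite oppr0 adde0.
Qed.

Section three_branch_map.
Variables (R : realType) (a b c : R).
Hypotheses (a0 : 0 < a) (b0 : 0 < b) (c0 : 0 < c) (abc : a + b + c = 1).

Definition branch3 (x : R) : 'I_3 :=
  if x < a then inord 0 else if x < a + b then inord 1 else inord 2.

Definition start3 (i : 'I_3) : R := [:: 0; a; a + b]`_i.

Definition length3 (i : 'I_3) : R := [:: a; b; c]`_i.

Definition map3 (x : R) : R :=
  (x - start3 (branch3 x)) / length3 (branch3 x).

Lemma length3_gt0 i : 0 < length3 i.
Proof. by rewrite /length3; case: i => [[|[|[|]]]]. Qed.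

Lemma branch3P (x : R) i : 0 <= x < 1 ->
  (branch3 x = i) <-> (start3 i <= x < start3 i + length3 i).
Proof.
move=> /andP[x0 x1]; rewrite /branch3; split.
  move=> <-; case: ltP => xa; last case: ltP => xab;
    rewrite /start3 /length3 !inordK//= ?x0 ?xa ?xab ?add0r//=.
  by rewrite abc.
move=> H; apply/val_inj; move: H.
case: i => [[|[|[|//]]]] ? /=; rewrite /start3 /length3/=.
- by rewrite add0r => /andP[_ ->]; rewrite inordK.
- by move=> /andP[ax ->]; rewrite ltNge ax/= inordK.
- move=> /andP[abx _]; rewrite !ifF ?inordK//.
    by apply/negbTE; rewrite -leNgt.
  by apply/negbTE; rewrite -leNgt (le_trans _ abx)// lerDl ltW.
Qed.

Let mlt (t : R) : measurable_fun [set: R] (fun x => x < t).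
Proof. by apply: measurable_fun_ltr. Qed.

Lemma measurable_map3 : measurable_fun [set: R] map3.
Proof.
pose phi i x : R := (x - start3 i) / length3 i.
have -> : map3 = fun x => if x < a then phi (inord 0) x else
    if x < a + b then phi (inord 1) x else phi (inord 2) x.
  apply/funext => x; rewrite /map3 /branch3.
  by case: ltP => // _; case: ltP.
have mphi i : measurable_fun [set: R] (phi i).
  by apply: measurable_funM => //; exact: measurable_funB.
by do 2 (apply: measurable_fun_ifT => //).
Qed.

Lemma measurable_branch3 i : measurable (branch3 @^-1` [set i]).
Proof.
rewrite [X in measurable X](_ : _ =
    (fun x => if x < a then inord 0 == i else
       if x < a + b then inord 1 == i else inord 2 == i) @^-1` [set true]).
  rewrite -[X in measurable X]setTI.
  by do 2 (apply: measurable_fun_ifT => //).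
by apply/seteqP; split => x /=; rewrite /branch3;
  case: ltP => _; [|case: ltP => _| |case: ltP => _] => /eqP.
Qed.

(** On each of the three intervals [map3] is an affine bijection onto [0, 1[, so
    the points that it sends into [A] form an affine copy of [A] in the unit
    interval, scaled by the length. *)
Lemma mu01_branch3 i (A : set R) : measurable A ->
  mu01 R (branch3 @^-1` [set i] `&` map3 @^-1` A) =
  ((length3 i)%:E * mu01 R A)%E.
Proof.
move=> mA; have l0 := length3_gt0 i.
have mT : measurable (map3 @^-1` A).
  by rewrite -[X in measurable X]setTI; exact: measurable_map3.
rewrite !mu01E//; last by apply: measurableI => //; exact: measurable_branch3.
rewrite -(lebesgue_measure_affine (start3 i) l0); last exact: measurableI.
congr (lebesgue_measure _); apply/seteqP; split => x /=; rewrite !in_itv/=.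
  move=> [[/[dup] xi + Ax] x01]; move/(branch3P _ x01) => /andP[sx xl].
  move: Ax; rewrite /map3 xi => Ax; split=> //.
  by rewrite divr_ge0 ?subr_ge0 ?(ltW l0)//= ltr_pdivrMr// mul1r ltrBlDl.
move=> [Ax /andP[]]; rewrite ltr_pdivrMr// mul1r ltrBlDl => + xl.
rewrite pmulr_lge0 ?invr_gt0// subr_ge0 => sx.
have s0 : 0 <= start3 i.
  by case: (i) => [[|[|[|//]]]] ? ; rewrite /start3//= ?addr_ge0// ltW.
have s1 : start3 i + length3 i <= 1.
  case: (i) => [[|[|[|//]]]] ? ; rewrite /start3 /length3/= -abc//.
  - by rewrite add0r -addrA lerDl addr_ge0// ltW.
  - by rewrite lerDl ltW.
have x01 : 0 <= x < 1 by rewrite (le_trans s0)//= (lt_le_trans xl).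
have xi : branch3 x = i by apply/(branch3P _ x01); rewrite sx.
by rewrite /map3 xi; split.
Qed.

End three_branch_map.

(** * The three-point law *)

(** Young's inequality for 2^s and 1 with exponents 1/s and 1/(1-s); it is
    the chord bound for the convex function 2^s between s = 0 and s = 1. *)
Lemma powR2_le1D (R : realType) (s : R) : 0 < s < 1 -> 2 `^ s <= 1 + s.
Proof.
move=> /andP[s0 s1]; have s1' : 0 < 1 - s by rewrite subr_gt0.
have := @conjugate_powR R (2 `^ s) 1 s^-1 (1 - s)^-1.
rewrite powR_ge0 ler01 !invr_gt0 s0 s1' !invrK subrKC => /(_ isT isT isT isT erefl).
rewrite mulr1 -powRrM mulfV ?gt_eqF// powRr1// powR1 mul1r => /le_trans; apply.
by lra.
Qed.

(** Through (1-t)^p <= exp(-pt) <= 1/(1+pt); only the first-order term matters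
    for what follows, and the quadratic error is made explicit. *)
Lemma powR_1B_le (R : realType) (p t : R) : 0 <= p -> 0 <= t <= 1 ->
  (1 - t) `^ p <= 1 - p * t + (p * t) ^+ 2.
Proof.
move=> p0 /andP[t0 t1].
have y0 : 0 <= p * t by rewrite mulr_ge0.
apply: (@le_trans _ _ (expR (- t) `^ p)).
  by rewrite ge0_ler_powR ?nnegrE ?subr_ge0 ?expR_ge0// expR_ge1Dx.
rewrite -expRM mulNr expRN mulrC.
apply: (@le_trans _ _ (1 + p * t)^-1).
  by rewrite lef_pV2 ?posrE ?expR_gt0 ?expR_ge1Dx// ltr_pwDl.
rewrite -[_^-1]mul1r ler_pdivrMr ?ltr_pwDl//.
by rewrite -subr_ge0; have -> : (1 - p * t + (p * t) ^+ 2) * (1 + p * t) - 1 = (p * t) ^+ 3;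
  [ring | rewrite exprn_ge0].
Qed.

(** The integrand of the difference between the two sides of the relation, for
    u = 1 and u_k - u equal to [t]. *)
Definition excess (R : realType) (p t : R) : R := `|1 + t| `^ p - `|t| `^ p - 1.

(** For 2 < p the linear terms in t add up to t (2^p - 2 - 2p).  With p = 2 + s,
    the bound 2^p <= 4 (1 + s) makes it at most -2 (1 - s) t, and the remaining
    terms are of orders t^(p-1) and t^2. *)
Lemma excess_neg (R : realType) (p : R) : 1 <= p -> p < 3 -> p != 2 ->
  exists2 t : R, 0 < t &
    (t + t `^ (p - 1)) * excess p 1 + 2 * excess p (- t) < 0.
Proof.
move=> p1 p3 p2.
have p0 : 0 < p := lt_le_trans ltr01 p1.
have e1 : excess p 1 = 2 `^ p - 2.
  rewrite /excess normr1 powR1 [1 + 1](_ : _ = 2)// ger0_norm//.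
  by rewrite -addrA -opprD.
have [plt2|pgt2|] := ltgtP p 2; last by move/eqP; rewrite (negbTE p2).
  exists 1 => //; rewrite e1 powR1 /excess subrr normr0 normrN1 powR1 powR0 ?gt_eqF//.
  have : (2 : R) `^ p < 2 ^+ 2.
    by rewrite -powR_mulrn// /powR pnatr_eq0/= ltr_expR ltr_pM2r// ln_gt0// ltr1n.
  by lra.
pose s := p - 2.
have s01 : 0 < s < 1 by rewrite /s; apply/andP; split; lra.
have /andP[s0 s1] := s01.
(* Choosing t as x^(1/s) gives t^s = x and t <= x, so t^(p-1) = t x and
   t^2 <= t x.  The remaining terms are at most (2 + 4 s) t x + 18 t x, which is
   below 24 t x because s < 1. *)
pose x := (1 - s) / 24.
have x0 : 0 < x by rewrite /x; lra.
have x1 : x <= 1 by rewrite /x; lra.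
pose t := x `^ s^-1.
have t0 : 0 < t by rewrite powR_gt0.
have tx : t <= x.
  by apply: ge1r_powR; rewrite ?x0 ?x1// invf_ge1// ltW.
have ts : t `^ s = x by rewrite -powRrM mulVf ?gt_eqF// powRr1// ltW.
have tp1 : t `^ (p - 1) = t * x.
  have -> : p - 1 = 1 + s by rewrite /s; ring.
  by rewrite powRD ?ts ?powRr1 ?(ltW t0)// (gt_eqF t0) implybT.
exists t => //.
have two_p : 2 `^ p <= 4 * (1 + s).
  have -> : p = 2%:R + s by rewrite /s; ring.
  rewrite powRD; last by rewrite pnatr_eq0 implybT.
  by rewrite powR_mulrn// -natrX ler_pM2l ?powR2_le1D.
have em : excess p (- t) <= - (p * t) + (p * t) ^+ 2.
  have := @powR_1B_le _ p t (ltW p0) _; rewrite (ltW t0) (le_trans tx x1) => /(_ isT).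
  rewrite /excess ger0_norm ?subr_ge0 ?(le_trans tx x1)//.
  have := powR_ge0 `|- t| p; lra.
rewrite e1 tp1.
apply: (@le_lt_trans _ _ (t * ((1 + x) * (2 + 4 * s) - 2 * (s + 2) + 18 * x))).
  have h1 : (t + t * x) * (2 `^ p - 2) <= t * ((1 + x) * (2 + 4 * s)).
    rewrite -{1}[t]mulr1 -mulrDr -mulrA ler_pM2l// ler_wpM2l//; first by lra.
    by lra.
  have h2 : (p * t) ^+ 2 <= 9 * (t * x).
    rewrite exprMn ler_pM ?sqr_ge0//; last by rewrite expr2 ler_pM2l.
    by rewrite (_ : 9 = 3 ^+ 2); [rewrite lerXn2r ?nnegrE; lra | ring].
  have ps : p * t = t * (s + 2) by rewrite /s; ring.
  have -> : t * ((1 + x) * (2 + 4 * s) - 2 * (s + 2) + 18 * x) =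
      t * ((1 + x) * (2 + 4 * s)) + 2 * (- (p * t) + 9 * (t * x)).
    by rewrite ps; ring.
  by apply: lerD => //; rewrite ler_pM2l// (le_trans em)// lerD2l.
rewrite pmulr_rlt0//.
have : 4 * s * x <= 4 * x by rewrite -mulrA ler_pM2l// ger_pMl// ltW.
have sE : s = 1 - 24 * x by rewrite /x; field.
by move: sE x0; clearbody s x; lra.
Qed.

Lemma sum3 (R : realType) (F : 'I_3 -> R) (x y z : R) :
  F (inord 0) = x -> F (inord 1) = y -> F (inord 2) = z ->
  \sum_i F i = x + y + z.
Proof.
move=> <- <- <-; rewrite !big_ord_recl big_ord0 addr0 addrA.
by congr (F _ + F _ + F _); apply/val_inj; rewrite /= inordK.
Qed.

(** Up to normalisation, both moments cancel in the same way: 1 contributes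
    t + t^(p-1), and the points -t and -1/t subtract t and t^(p-1), in this order
    for the mean and in the opposite order for the moment of order p - 1. *)
Lemma three_point_law (R : realType) (p : R) : 1 <= p -> p < 3 -> p != 2 ->
  exists (a b c : R) (e : 'I_3 -> R),
    [/\ [/\ 0 < a, 0 < b, 0 < c & a + b + c = 1],
        \sum_i length3 a b c i * e i = 0,
        \sum_i length3 a b c i * (`|e i| `^ (p - 2) * e i) = 0
      & \sum_i length3 a b c i * excess p (e i) < 0].
Proof.
move=> p1 p3 p2; have [t t0 Ht] := excess_neg p1 p3 p2.
have pw0 r : 0 < t `^ r by exact: powR_gt0.
pose Z := 1 + t + t `^ (p - 1) + t `^ p.
have Z0 : 0 < Z by rewrite /Z !addr_gt0.
have tp1 : t * t `^ (p - 1) = t `^ p.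
  by rewrite mulr_powRB1 ?(ltW t0)// (lt_le_trans ltr01).
have tp2 : t * t `^ (p - 2) = t `^ (p - 1).
  have -> : p - 1 = 1 + (p - 2) by ring.
  by rewrite [RHS]powRD ?powRr1 ?(ltW t0)// (gt_eqF t0) implybT.
exists ((t + t `^ (p - 1)) / Z), (1 / Z), (t `^ p / Z),
  (fun i => [:: 1; - t; - t^-1]`_i).
rewrite !divr_gt0 ?addr_gt0//; split.
- by split=> //; rewrite -!mulrDl -[RHS](@divff _ Z) ?gt_eqF//; congr (_ / _);
    rewrite /Z; ring.
- rewrite (sum3 (x := (t + t `^ (p - 1)) / Z * 1) (y := 1 / Z * - t)
     (z := t `^ p / Z * - t^-1)) ?/length3 ?inordK//.
  by rewrite -tp1; field; rewrite !gt_eqF.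
- rewrite (sum3 (x := (t + t `^ (p - 1)) / Z * (`|1| `^ (p - 2) * 1))
     (y := 1 / Z * (`|- t| `^ (p - 2) * - t))
     (z := t `^ p / Z * (`|- t^-1| `^ (p - 2) * - t^-1))) ?/length3 ?inordK//.
  rewrite !normrN normr1 powR1 !gtr0_norm ?invr_gt0//.
  have -> : t^-1 `^ (p - 2) = (t `^ (p - 2))^-1.
    by rewrite -powR_inv1 ?(ltW t0)// -powRrM mulrC powRrM powR_inv1// powR_ge0.
  rewrite -tp1 -tp2; field.
  by rewrite !gt_eqF.
- rewrite (sum3 (x := (t + t `^ (p - 1)) / Z * excess p 1)
     (y := 1 / Z * excess p (- t))
     (z := t `^ p / Z * excess p (- t^-1))) ?/length3 ?inordK//.
  (* The points -t and -1/t carry the same share of the expected excess. *)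
  have dual : t `^ p * excess p (- t^-1) = excess p (- t).
    have ti0 : 0 < t^-1 by rewrite invr_gt0.
    have scale z : t `^ p * `|z| `^ p = `|t * z| `^ p.
      by rewrite normrM (gtr0_norm t0) powRM ?(ltW t0).
    rewrite /excess mulrBr mulrBr !scale mulr1 mulrDr mulr1 mulrN mulfV ?gt_eqF//.
    by rewrite !normrN normr1 powR1 (gtr0_norm t0) distrC addrAC.
  have -> : (t + t `^ (p - 1)) / Z * excess p 1 + 1 / Z * excess p (- t) +
      t `^ p / Z * excess p (- t^-1) =
      ((t + t `^ (p - 1)) * excess p 1 + 2 * excess p (- t)) / Z.
    rewrite [t `^ p / Z * _]mulrAC dual; field; rewrite gt_eqF//.
  by rewrite pmulr_llt0 ?invr_gt0.
Qed.

Theorem corollary3p5 (R : realType) (p : R)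
    (p_ge1 : (1 <= p%:E)%E) (p_lt3 : p < 3) (p_neq2 : p != 2) :
  exists v : nat -> R -> R,
    [/\ forall k, v k \in Lfun (mu01 R) +oo%E,
        weak_cvg (mu01 R) p_ge1 v (cst 0),
        weak_cvg (mu01 R) (q := hoelder_conjugate p%:E) (hoelder_conj_ge1 p_ge1)
          (fun k x => `|v k x| `^ (p - 2) * v k x) (cst 0)
      & let u_ k x := 1 + v k x in
        let u : R -> R := cst 1 in
        ~ ge_o1
            (fun k => \int[mu01 R]_x (`|u_ k x| `^ p)%:E)%E
            (fun k => \int[mu01 R]_x (`|u x| `^ p)%:E
                      + \int[mu01 R]_x (`|u_ k x - u x| `^ p)%:E)%E].
Proof.
have [a [b [c [e [[a0 b0 c0 abc] mean_e mean_pe lt0]]]]] :=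
  three_point_law p_ge1 p_lt3 p_neq2.
have mu1 := mu01_setT R.
pose m := length3 a b c; pose S := map3 a b c; pose br := branch3 a b.
have mbr : forall i, measurable (br @^-1` [set i]) by exact: measurable_branch3.
have mS : measurable_fun [set: R] S by exact: measurable_map3.
have m0 i : 0 <= m i by rewrite ltW// length3_gt0.
have brS i A : measurable A ->
  mu01 R (br @^-1` [set i] `&` S @^-1` A) = ((m i)%:E * mu01 R A)%E.
  exact: mu01_branch3.
pose v k x := e (br (iter k S x)).
exists v; split.
- move=> k; apply: (bounded_Lfun mu1 (C := \sum_i `|e i|)) => //.
  + exact: leey.
  + exact: (measurable_symbol mbr mS e k).
  + by move=> x; rewrite /v (bigD1 (br (iter k S x)))//= lerDl sumr_ge0.
- exact: (symbol_weak_cvg0 mu1 mbr mS m0 brS).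
- exact: (symbol_weak_cvg0 mu1 mbr mS m0 brS (e := fun i => `|e i| `^ (p - 2) * e i)).
- move=> u_ u [eps [eps0 Heps]].
  pose lhs := \sum_i m i * `|1 + e i| `^ p.
  pose rhs := \sum_i m i * `|1 + e i - 1| `^ p.
  have I0 : (\int[mu01 R]_x (`|u x| `^ p)%:E = 1)%E.
    under eq_integral do rewrite /u /cst normr1 powR1.
    by rewrite integral_cst// mul1e; exact: mu1.
  (* This gap does not depend on [k], so no sequence that tends to 0 fills it. *)
  have gap : lhs - rhs - 1 < 0.
    have sm : \sum_i m i = 1.
      by rewrite (sum3 (x := a) (y := b) (z := c)) ?/m ?/length3 ?inordK.
    have <- : \sum_i m i * excess p (e i) = lhs - rhs - 1; last exact: lt0.
    rewrite -sm -!sumrB; apply: eq_bigr => i _.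
    by rewrite /excess [1 + e i - 1]addrAC subrr add0r; ring.
  have : \forall k \near \oo, lhs - rhs - 1 < eps k.
    exact: (cvgr_gt _ eps0).
  move=> [N _ /(_ N (leqnn N))] /=; apply/negP; rewrite -leNgt.
  have := Heps N; rewrite I0.
  have -> : (\int[mu01 R]_x (`|u_ N x| `^ p)%:E = lhs%:E)%E.
    exact: (integral_symbol mu1 mbr mS m0 brS (fun i => `|1 + e i| `^ p)).
  have -> : (\int[mu01 R]_x (`|u_ N x - u x| `^ p)%:E = rhs%:E)%E.
    exact: (integral_symbol mu1 mbr mS m0 brS (fun i => `|1 + e i - 1| `^ p)).
  by rewrite -!EFinD lee_fin; lra.
Qed.
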